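(* Let $\mathcal{H}$ be a Hilbert space, $T$ an invertible bounded linear operator on $\mathcal{H}$, $J$ a countable (finite or countably infinite) index set, and $f_j\in\mathcal{H}$ for $j\in J$. Then $\{T^nf_j:n\in\mathbb{Z},\ j\in J\}$ is a frame for $\mathcal{H}$ if and only if there exist a doubly invariant closed subspace $K\subset L^2(\mathbb{T},\ell^2(J))$ and an invertible operator $V:K\to\mathcal{H}$ such that $$V^{-1}TV=U|_K\quad\text{and}\quad V(P_Ke_j)=f_j\ \text{ for all } j\in J,$$ where $\{e_j\}_{j\in J}$ is the standard basis of $\ell^2(J)$.
   Context: $\mathbb{T}$ is the unit circle. A countable indexed family $\{x_i\}$ in a Hilbert space $\mathcal{H}$ is a frame for $\mathcal{H}$ if there are constants $A,B>0$ with $A\|h\|^2\le\sum_i|\langle h,x_i\rangle|^2\le B\|h\|^2$ for all $h\in\mathcal{H}$. $L^2(\mathbb{T},\ell^2(J))$ is the space of $L^2$ functions from $\mathbb{T}$ into $\ell^2(J)$, i.e. $g(z)=\sum_{n\in\mathbb{Z}}a_nz^n$ with $a_n\in\ell^2(J)$ and $\|g\|^2=\sum_{n\in\mathbb{Z}}\|a_n\|^2_{\ell^2(J)}<\infty$; $\ell^2(J)$ is identified with the subspace of constant functions. The bilateral shift $U$ is multiplication by $z$ on $L^2(\mathbb{T},\ell^2(J))$ (a unitary operator). A closed subspace $K$ is doubly invariant if both $K$ and $K^\perp$ are $U$-invariant, equivalently $K$ is invariant under $U$ and $U^*$. $P_K$ is the orthogonal projection onto $K$. An invertible operator is a bounded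 linear bijection with bounded inverse. *)

(* Defs.v *)
From HB Require Import structures.
From mathcomp Require Import all_boot all_order all_algebra ring lra complex finmap.
From mathcomp Require Import all_classical all_reals all_analysis.
Set Implicit Arguments.
Unset Strict Implicit.
Unset Printing Implicit Defensive.
Import Order.TTheory GRing.Theory Num.Theory.
Import numFieldNormedType.Exports.
Local Open Scope classical_set_scope.
Local Open Scope ring_scope.

Section predot.
Variables (C : numClosedFieldType) (V : lmodType C) (d : V -> V -> C).
Hypothesis dl : forall a x y z, d (a *: x + y) z = a * d x z + d y z.
Hypothesis dc : forall x y, d y x = (d x y)^*.
Hypothesis dge0 : forall x, 0 <= d x x.

Lemma pdDl x y z : d (x + y) z = d x z + d y z.
Proof. by rewrite -[x]scale1r dl mul1r scale1r. Qed.
Lemma pd0l z : d 0 z = 0.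
Proof. by apply: (addIr (d 0 z)); rewrite -pdDl !add0r. Qed.
Lemma pdZl a x z : d (a *: x) z = a * d x z.
Proof. by rewrite -[a *: x]addr0 dl pd0l addr0. Qed.
Lemma pdDr x y z : d z (x + y) = d z x + d z y.
Proof. by rewrite dc pdDl rmorphD /= -!dc. Qed.
Lemma pdZr a x z : d z (a *: x) = a^* * d z x.
Proof. by rewrite dc pdZl rmorphM /= -dc. Qed.

Lemma pd_cs x y : (forall x, d x x = 0 -> x = 0) ->
  `|d x y| ^+ 2 <= d x x * d y y.
Proof.
move=> d0; have [y0|yn0] := eqVneq (d y y) 0.
  by rewrite (d0 _ y0) dc !pd0l mulr0 rmorph0 normr0 expr0n.
have yp : 0 < d y y by rewrite lt_def yn0 dge0.
have := dge0 (x + (- (d x y / d y y)) *: y).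
rewrite pdDr !pdDl !pdZr !pdZl (dc x y) rmorphN rmorphM fmorphV /= -(dc y y).
rewrite (_ : _ + _ = d x x - d x y * (d x y)^* / d y y); last by field.
by rewrite -normCK subr_ge0 ler_pdivrMr.
Qed.

Lemma pd_triangle x y : (forall x, d x x = 0 -> x = 0) ->
  sqrtC (d (x + y) (x + y)) <= sqrtC (d x x) + sqrtC (d y y).
Proof.
move=> d0.
rewrite -(@ler_pXn2r _ 2) ?nnegrE ?addr_ge0 ?sqrtC_ge0//.
rewrite sqrtCK sqrrD !sqrtCK pdDr !pdDl (dc x y).
have -> : d x x + (d x y)^* + (d x y + d y y) = d x x + 'Re (d x y) *+ 2 + d y y.
  by rewrite ReE; set z := _^*; set w := d x y; field.
rewrite lerD2r lerD2l lerMn2r/=.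
have h : `|'Re (d x y)| <= sqrtC (d x x) * sqrtC (d y y).
  apply: (le_trans (leif_normC_Re_Creal _)).
  rewrite -(@ler_pXn2r _ 2) ?nnegrE ?mulr_ge0 ?sqrtC_ge0//.
  by rewrite exprMn !sqrtCK pd_cs.
by apply: le_trans h; rewrite real_ler_norm// Creal_Re.
Qed.
End predot.

(* The inner product is linear in its first argument. The norm of a
   normedModType R[i] takes its values in R[i]; norm2 is the real number
   `|x|^2. *)
HB.mixin Record isHilbert (R : realType) H of CompleteNormedModule R[i] H := {
  dot : H -> H -> R[i];
  dot_linearl : forall a x y z, dot (a *: x + y) z = a * dot x z + dot y z;
  dot_conj : forall x y, dot y x = (dot x y)^*;
  dot_normE : forall x, dot x x = `|x| ^+ 2
}.

#[short(type="hilbertType")]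
HB.structure Definition Hilbert (R : realType) :=
  {H of isHilbert R H & CompleteNormedModule R[i] H}.

Definition norm2 (R : realType) (V : normedZmodType R[i]) (x : V) : R :=
  complex.Re (`|x| ^+ 2).

(* Unordered sum of an absolutely summable family; a junk value otherwise. *)
Definition rsum (R : realType) (I : choiceType) (f : I -> R) : R :=
  fine (\esum_(i in [set: I]) (EFin \o f)^\+ i
        - \esum_(i in [set: I]) (EFin \o f)^\- i)%E.

Definition csum (R : realType) (I : choiceType) (F : I -> R[i]) : R[i] :=
  Complex (rsum (fun i => complex.Re (F i))) (rsum (fun i => complex.Im (F i))).


Section C_complete.
Variable R : realType.
Implicit Types x y z : R[i].

Lemma norm_real (V : normedZmodType R[i]) (x : V) :
  `|x| = (complex.Re `|x|)%:C%C.
Proof. by rewrite RRe_real// normr_real. Qed.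

Lemma norm_le_ReIm z : `|z| <= (`|complex.Re z| + `|complex.Im z|)%:C%C.
Proof.
have nr (a : R) : `|a%:C%C| = `|a|%:C%C.
  by rewrite normc_def /= expr0n /= addr0 sqrtr_sqr.
have ni : `|'i%C : R[i]| = 1.
  by rewrite normc_def /= expr0n expr1n /= add0r sqrtr1.
rewrite {1}[z]complexE; apply: (le_trans (ler_normD _ _)).
by rewrite normrM ni mul1r !nr rmorphD.
Qed.

Lemma normc_ge_Im z : `|complex.Im z|%:C%C <= `|z|.
Proof.
rewrite normc_def lecR -sqrtr_sqr ler_wsqrtr//.
by rewrite lerDr sqr_ge0.
Qed.

Lemma C_complete (F : set_system R[i]^o) : ProperFilter F -> cauchy F -> cvg F.
Proof.
move=> FF /cauchyP cF.
have part (p : R[i] -> R) : (forall x y, p (x - y) = p x - p y) ->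
    (forall z, `|p z|%:C%C <= `|z|) -> cvg (p @ F).
  move=> pB pn; apply: R_complete.
  apply: cauchy_exP => e e0.
  have /cF : 0 < e%:C%C :> R[i] by rewrite ltcR.
  move=> [x Fx]; exists (p x).
  rewrite /nbhs/=; apply: filterS Fx => y xy.
 change (`|p x - p y| < e).
  by rewrite -pB -ltcR; apply: le_lt_trans xy.
have /cvg_ex[a Fa] := part _ (raddfB (@complex.Re R : Rcomplex R -> R)) (@normc_ge_Re _).
have /cvg_ex[b Fb] := part _ (raddfB (@complex.Im R : Rcomplex R -> R)) normc_ge_Im.
apply/cvg_ex; exists (Complex a b).
apply/cvgrPdist_lt => e e0.
have e_real : e = (complex.Re e)%:C%C by rewrite RRe_real// gtr0_real.
have e0' : 0 < complex.Re e by rewrite -ltcR -e_real.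
near=> z.
apply: (le_lt_trans (norm_le_ReIm _)).
rewrite e_real ltcR [ltRHS]splitr ltrD//.
  rewrite (raddfB (@complex.Re R : Rcomplex R -> R))/=; near: z.
  by move/cvgrPdist_lt : Fa; apply; rewrite divr_gt0.
rewrite (raddfB (@complex.Im R : Rcomplex R -> R))/=; near: z.
by move/cvgrPdist_lt : Fb; apply; rewrite divr_gt0.
Unshelve. all: by end_near. Qed.

(* The complex numbers as a Hilbert space over themselves. An alias is needed
   because completeness cannot be declared on R[i]^o: the canonical structures
   of _^o already contain an instance that is restricted to realType. *)
Definition Cplx : Type := R[i].
HB.instance Definition _ := NormedModule.copy Cplx R[i]^o.
HB.instance Definition _ := Uniform_isComplete.Build Cplx C_complete.

Let cdot (x y : Cplx) : R[i] := (x : R[i]) * (y : R[i])^*.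
Let cdot_linearl a x y z : cdot (a *: (x : Cplx) + y) z = a * cdot x z + cdot y z.
Proof. by rewrite /cdot mulrDl mulrA. Qed.
Let cdot_conj x y : cdot y x = (cdot x y)^*.
Proof. by rewrite /cdot rmorphM /= conjCK mulrC. Qed.
Let cdot_normE x : cdot x x = `|x : Cplx| ^+ 2.
Proof. by rewrite /cdot -normCK. Qed.
HB.instance Definition _ :=
  @isHilbert.Build R Cplx cdot cdot_linearl cdot_conj cdot_normE.

End C_complete.

Section sums.
Variables (R : realType) (I : choiceType).
Implicit Types (a : R) (f g p q : I -> R) (F G : I -> R[i]).
Local Notation S a := (esum [set: I] a).

Lemma esumZl (a : R) (f : I -> \bar R) : 0 <= a -> (forall i, 0 <= f i)%E ->
  (S (fun i => a%:E * f i) = a%:E * S f)%E.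
Proof.
move=> a0 f0; rewrite /esum -ereal_supZl//; last first.
  by apply/set0P; exists (\sum_(x \in set0) f x)%E; exists set0 => //; exact: fsets_set0.
congr ereal_sup; apply/seteqP; split => [_ [A AS <-]|_ [_ [A AS <-] <-]].
  exists (\sum_(x \in A) f x)%E; first by exists A.
  by rewrite ge0_mule_fsumr.
by exists A => //; rewrite ge0_mule_fsumr.
Qed.

Definition rsummable f := summable [set: I] (EFin \o f).

Lemma rsumE f p q : (forall i, 0 <= p i) -> (forall i, 0 <= q i) ->
  rsummable p -> rsummable q -> (forall i, f i = p i - q i) ->
  rsum f = fine (S (EFin \o p)) - fine (S (EFin \o q)).
Proof.
move=> p0 q0 ps qs fpq.
have -> : f = (fun i => p i - q i) by apply/funext.
rewrite /rsum (_ : EFin \o _ = (EFin \o p) \- (EFin \o q))%E; last first.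
  by apply/funext => i; rewrite /= EFinB.
rewrite esumB//; [|by move=> i _; rewrite lee_fin..].
have H (h : I -> R) : (forall i, 0 <= h i) -> rsummable h -> S (EFin \o h) \is a fin_num.
  move=> h0; rewrite /rsummable summableE (@eq_esum _ _ _ _ (EFin \o h))//.
  by move=> i _; rewrite /= ger0_norm.
by rewrite fineB// H.
Qed.

Lemma rsummable_le f g : (forall i, `|f i| <= g i) -> rsummable g -> rsummable f.
Proof.
move=> fg; apply: le_lt_trans; apply: le_esum => i _ /=.
by rewrite lee_fin (le_trans (fg i))// ler_norm.
Qed.

Lemma rsummableD f g : rsummable f -> rsummable g -> rsummable (fun i => f i + g i).
Proof.
move=> fs gs; have := summableD fs gs; rewrite /rsummable.
by congr summable; apply/funext => i /=; rewrite EFinD.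
Qed.

Lemma rsummableZ a f : rsummable f -> rsummable (fun i => a * f i).
Proof.
move=> fs; rewrite /rsummable /summable.
rewrite (@eq_esum _ _ _ _ (fun i => `|a|%:E * `|f i|%:E)%E); last first.
  by move=> i _ /=; rewrite normrM EFinM.
by rewrite esumZl// lte_mul_pinfty// lee_fin.
Qed.

Lemma rsum_split f : rsummable f ->
  exists p q, [/\ (forall i, 0 <= p i), (forall i, 0 <= q i),
    rsummable p, rsummable q & forall i, f i = p i - q i].
Proof.
move=> fs; exists (fun i => Num.max (f i) 0), (fun i => Num.max (- f i) 0).
split.
- by move=> i; rewrite le_max lexx orbT.
- by move=> i; rewrite le_max lexx orbT.
- apply: (@rsummable_le _ (fun i => `|f i|)).
    by move=> i; rewrite ger0_norm ?le_max ?lexx ?orbT// ge_max normr_ge0 ler_norm.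
  move: fs; rewrite /rsummable /summable; apply: le_lt_trans.
  by apply: le_esum => i _ /=; rewrite normr_id.
- apply: (@rsummable_le _ (fun i => `|f i|)).
    by move=> i; rewrite ger0_norm ?le_max ?lexx ?orbT// ge_max normr_ge0 -normrN ler_norm.
  move: fs; rewrite /rsummable /summable; apply: le_lt_trans.
  by apply: le_esum => i _ /=; rewrite normr_id.
- move=> i; have [f0|f0] := leP 0 (f i).
    by rewrite max_r ?subr0// oppr_le0.
  by rewrite max_l ?opprK ?add0r// oppr_ge0 ltW.
Qed.

Lemma fineSD p q : (forall i, 0 <= p i) -> (forall i, 0 <= q i) ->
  rsummable p -> rsummable q ->
  fine (S (EFin \o (fun i => p i + q i))) = fine (S (EFin \o p)) + fine (S (EFin \o q)).
Proof.
move=> p0 q0 ps qs.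
have H (h : I -> R) : (forall i, 0 <= h i) -> rsummable h -> S (EFin \o h) \is a fin_num.
  move=> h0; rewrite /rsummable summableE (@eq_esum _ _ _ _ (EFin \o h))//.
  by move=> i _; rewrite /= ger0_norm.
rewrite -fineD ?H// -esumD//; try by move=> i _; rewrite lee_fin.
Qed.

Lemma rsumD f g : rsummable f -> rsummable g ->
  rsum (fun i => f i + g i) = rsum f + rsum g.
Proof.
move=> /rsum_split[p [q [p0 q0 ps qs fE]]] /rsum_split[p' [q' [p'0 q'0 p's q's gE]]].
rewrite (rsumE p0 q0 ps qs fE) (rsumE p'0 q'0 p's q's gE).
rewrite (@rsumE _ (fun i => p i + p' i) (fun i => q i + q' i)).
- rewrite (fineSD p0 p'0 ps p's) (fineSD q0 q'0 qs q's).
  by ring.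
- by move=> i; rewrite addr_ge0.
- by move=> i; rewrite addr_ge0.
- exact: rsummableD.
- exact: rsummableD.
- by move=> i; rewrite fE gE; ring.
Qed.

Lemma fineSZ a p : 0 <= a -> (forall i, 0 <= p i) ->
  fine (S (EFin \o (fun i => a * p i))) = a * fine (S (EFin \o p)).
Proof.
move=> a0 p0; have -> : S (EFin \o (fun i => a * p i)) = (a%:E * S (EFin \o p))%E.
  by rewrite -esumZl//; apply: eq_esum => i _; rewrite /= EFinM.
have := @esum_ge0 R I [set: I] (EFin \o p) (fun i _ => p0 i).
case: (S (EFin \o p)) => [r _|_|]//=.
by rewrite mulr0 mulry; case: sgrP => //=; rewrite ?mul0e ?mul1e ?mulN1e.
Qed.

Lemma rsumZ a f : rsummable f -> rsum (fun i => a * f i) = a * rsum f.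
Proof.
move=> /rsum_split[p [q [p0 q0 ps qs fE]]].
rewrite (rsumE p0 q0 ps qs fE); have [a0|a0] := leP 0 a.
  rewrite (@rsumE _ (fun i => a * p i) (fun i => a * q i)).
  - by rewrite (fineSZ a0 p0) (fineSZ a0 q0) mulrBr.
  - by move=> i; rewrite mulr_ge0.
  - by move=> i; rewrite mulr_ge0.
  - exact: rsummableZ.
  - exact: rsummableZ.
  - by move=> i; rewrite fE mulrBr.
have Na0 : 0 <= - a by rewrite oppr_ge0 ltW.
rewrite (@rsumE _ (fun i => - a * q i) (fun i => - a * p i)).
- by rewrite (fineSZ Na0 p0) (fineSZ Na0 q0); ring.
- by move=> i; rewrite mulr_ge0.
- by move=> i; rewrite mulr_ge0.
- exact: rsummableZ.
- exact: rsummableZ.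
- by move=> i; rewrite fE; ring.
Qed.

Definition csummable F := rsummable (fun i => complex.Re `|F i|).

Lemma csummableP F : csummable F ->
  rsummable (fun i => complex.Re (F i)) /\ rsummable (fun i => complex.Im (F i)).
Proof.
move=> Fs; split; apply: rsummable_le Fs => i; rewrite -lecR -norm_real.
  exact: normc_ge_Re.
exact: normc_ge_Im.
Qed.

Lemma csumP (a : R[i]) F G : csummable F -> csummable G ->
  csum (fun i => a * F i + G i) = a * csum F + csum G.
Proof.
move=> /csummableP[F1 F2] /csummableP[G1 G2].
rewrite /csum.
have -> : (fun i => complex.Re (a * F i + G i)) =
    (fun i => complex.Re a * complex.Re (F i) +
      (- complex.Im a * complex.Im (F i) + complex.Re (G i))).
  by apply/funext => i; case: a (F i) (G i) => [a b] [c d] [e f]/=; ring.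
have -> : (fun i => complex.Im (a * F i + G i)) =
    (fun i => complex.Re a * complex.Im (F i) +
      (complex.Im a * complex.Re (F i) + complex.Im (G i))).
  by apply/funext => i; case: a (F i) (G i) => [a b] [c d] [e f]/=; ring.
rewrite (rsumD (rsummableZ _ F1) (rsummableD (rsummableZ _ F2) G1)).
rewrite (rsumD (rsummableZ _ F2) G1).
rewrite (rsumD (rsummableZ _ F2) (rsummableD (rsummableZ _ F1) G2)).
rewrite (rsumD (rsummableZ _ F1) G2).
rewrite (rsumZ (complex.Re a) F1) (rsumZ (- complex.Im a) F2).
rewrite (rsumZ (complex.Re a) F2) (rsumZ (complex.Im a) F1).
case: a => a b; apply/eqP; rewrite eq_complex /=.
by apply/andP; split; apply/eqP; ring.
Qed.

Lemma csum_conj F : csummable F -> csum (fun i => (F i)^*) = (csum F)^*.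
Proof.
move=> /csummableP[F1 F2]; rewrite /csum.
apply/eqP; rewrite eq_complex /=; apply/andP; split; apply/eqP => //.
  by congr rsum; apply/funext => i; case: (F i).
rewrite -mulN1r -rsumZ//; congr rsum; apply/funext => i.
by case: (F i) => a b /=; rewrite mulN1r.
Qed.

Lemma rsum_ge0 f : (forall i, 0 <= f i) -> rsummable f -> rsum f = fine (S (EFin \o f)).
Proof.
move=> f0 fs; rewrite (@rsumE f f (fun=> 0))//.
- by rewrite [X in _ - fine X]esum1// subr0.
- by rewrite /rsummable /summable esum1// => i _ /=; rewrite normr0.
- by move=> i; rewrite subr0.
Qed.

Lemma csum_ge0 F f : (forall i, 0 <= f i) -> rsummable f ->
  (forall i, F i = (f i)%:C%C) -> csum F = (fine (S (EFin \o f)))%:C%C.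
Proof.
move=> f0 fs FE; rewrite /csum -rsum_ge0//.
apply/eqP; rewrite eq_complex /=; apply/andP; split; apply/eqP.
  by congr rsum; apply/funext => i; rewrite FE.
rewrite (_ : (fun i => _) = (fun i => 0 * f i)); first by rewrite rsumZ// mul0r.
by apply/funext => i; rewrite FE mul0r.
Qed.

End sums.

Section hilbert_theory.
Variables (R : realType) (H : hilbertType R).
Implicit Types x y z : H.

Lemma norm2E (V : normedZmodType R[i]) (x : V) : (norm2 x)%:C%C = `|x| ^+ 2.
Proof. by rewrite /norm2 RRe_real// rpredX// normr_real. Qed.

Lemma norm2_ge0 (V : normedZmodType R[i]) (x : V) : 0 <= norm2 x.
Proof. by rewrite -lecR norm2E exprn_ge0. Qed.

Lemma norm2_rnorm (V : normedZmodType R[i]) (x : V) : norm2 x = complex.Re `|x| ^+ 2.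
Proof. by apply: complexI; rewrite norm2E rmorphXn /= -norm_real. Qed.

Lemma dot_ge0 x : 0 <= dot x x.
Proof. by rewrite dot_normE exprn_ge0. Qed.

Lemma dot_eq0 x : dot x x = 0 -> x = 0.
Proof. by rewrite dot_normE => /eqP; rewrite expf_eq0 normr_eq0 => /eqP. Qed.

Lemma dot_CS x y : `|dot x y| <= `|x| * `|y|.
Proof.
rewrite -(@ler_pXn2r _ 2) ?nnegrE ?mulr_ge0// exprMn -!dot_normE.
exact: (pd_cs (@dot_linearl _ H) (@dot_conj _ H) dot_ge0 _ _ dot_eq0).
Qed.

Lemma Re_norm_ge0 (V : normedZmodType R[i]) (x : V) : 0 <= complex.Re `|x|.
Proof. by rewrite -ler0c -norm_real normr_ge0. Qed.

Lemma dot_le_norm2 x y : complex.Re `|dot x y| <= norm2 x + norm2 y.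
Proof.
have /= := dot_CS x y; rewrite norm_real (norm_real x) (norm_real y) -rmorphM lecR.
rewrite !norm2_rnorm; move/le_trans; apply.
set a := complex.Re _; set b := complex.Re _.
have a0 : 0 <= a by exact: Re_norm_ge0.
have b0 : 0 <= b by exact: Re_norm_ge0.
nra.
Qed.

Lemma norm2D x y : norm2 (x + y) <= 2 * norm2 x + 2 * norm2 y.
Proof.
have := ler_normD x y; rewrite (norm_real (x + y)) (norm_real x) (norm_real y) -rmorphD lecR.
rewrite !norm2_rnorm.
set a := complex.Re _; set b := complex.Re _; set c := complex.Re _ => h.
have a0 : 0 <= a by exact: Re_norm_ge0.
have : 0 <= (b - c) ^+ 2 by exact: sqr_ge0.
have : a ^+ 2 <= (b + c) ^+ 2 by rewrite ler_pXn2r// nnegrE (le_trans a0).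
nra.
Qed.

Lemma norm2Z (a : R[i]) x : norm2 (a *: x) = norm2 a * norm2 x.
Proof. by apply: complexI; rewrite rmorphM /= !norm2E normrZ exprMn. Qed.

Lemma norm2_0 : norm2 (0 : H) = 0.
Proof. by rewrite norm2_rnorm normr0 expr0n. Qed.

End hilbert_theory.

Section hsum_def.
Variables (R : realType) (I : choiceType) (E : hilbertType R).

Definition sqsummable (x : I -> E) : Prop :=
  (\esum_(i in [set: I]) (norm2 (x i))%:E < +oo)%E.

Definition sqsummable_pred : {pred I -> E} := fun x => `[< sqsummable x >].

(* The Hilbert space l^2(I; E). *)
Record hsum : Type := HSum { hsum_fun :> I -> E; _ : sqsummable_pred hsum_fun }.
HB.instance Definition _ := [isSub for hsum_fun].
HB.instance Definition _ := [Choice of hsum by <:].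

Lemma sqsummableP x : sqsummable x <-> rsummable (fun i => norm2 (x i)).
Proof.
by rewrite /rsummable /summable; under eq_esum do rewrite /= ger0_norm ?norm2_ge0//.
Qed.

Lemma sqsummable_closed : submod_closed sqsummable_pred.
Proof.
split=> [|a x y /asboolP/sqsummableP xs /asboolP/sqsummableP ys]; apply/asboolP.
  by rewrite /sqsummable esum1// => i _; rewrite norm2_0.
apply/sqsummableP; apply: (@rsummable_le _ _ _
  (fun i => 2 * norm2 a * norm2 (x i) + 2 * norm2 (y i))).
  move=> i; rewrite ger0_norm ?norm2_ge0//.
  by apply: (le_trans (norm2D _ _)); rewrite norm2Z mulrA.
by apply: rsummableD; exact: rsummableZ.
Qed.

HB.instance Definition _ := GRing.SubChoice_isSubLmodule.Build R[i] (I -> E)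
  sqsummable_pred hsum (GRing.submod_closed_semi sqsummable_closed).

Definition hdot (x y : hsum) : R[i] := csum (fun i => dot (x i) (y i)).

Lemma hsum_summable (x : hsum) : rsummable (fun i => norm2 (x i)).
Proof. by case: x => f fs; exact: (sqsummableP f).1 (asboolW fs). Qed.

Lemma hdot_summable (x y : hsum) : csummable (fun i => dot (x i) (y i)).
Proof.
apply: (rsummable_le _ (rsummableD (hsum_summable x) (hsum_summable y))) => i.
by rewrite ger0_norm ?Re_norm_ge0// dot_le_norm2.
Qed.

Lemma hdot_linearl a x y z : hdot (a *: x + y) z = a * hdot x z + hdot y z.
Proof.
rewrite /hdot -csumP; [|exact: hdot_summable..].
by congr csum; apply/funext => i; rewrite -dot_linearl.
Qed.

Lemma hdot_conj x y : hdot y x = (hdot x y)^*.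
Proof.
rewrite /hdot -csum_conj; last exact: hdot_summable.
by congr csum; apply/funext => i; rewrite -dot_conj.
Qed.

Lemma hdotxx (x : hsum) :
  hdot x x = (fine (\esum_(i in [set: I]) (norm2 (x i))%:E))%:C%C.
Proof.
apply: csum_ge0 => [i||i]; [exact: norm2_ge0|exact: hsum_summable|].
by rewrite norm2E dot_normE.
Qed.

Lemma hdot_ge0 x : 0 <= hdot x x.
Proof.
rewrite hdotxx lecR fine_ge0// esum_ge0// => i _.
by rewrite lee_fin norm2_ge0.
Qed.

Lemma hdot_fsum (x : hsum) (A : {fset I}) : \sum_(i <- A) norm2 (x i) <= complex.Re (hdot x x).
Proof.
rewrite hdotxx /= -lee_fin fineK; last first.
  rewrite ge0_fin_numE; last by apply: esum_ge0 => i _; rewrite lee_fin norm2_ge0.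
  by have := hsum_summable x; rewrite -sqsummableP.
apply: ereal_sup_ubound => /=; exists [set` A].
  by split => //; exact: finite_fset.
by rewrite fsbig_finite//= set_fsetK sumEFin.
Qed.

Lemma hdot_norm2 (x : hsum) i : norm2 (x i) <= complex.Re (hdot x x).
Proof. by have := hdot_fsum x [fset i]%fset; rewrite big_seq_fset1. Qed.

Lemma hdot_eq0 x : hdot x x = 0 -> x = 0.
Proof.
move=> x0; apply/val_inj/funext => i /=.
have := hdot_norm2 x i; rewrite x0 /= => h.
have /eqP : norm2 (x i) = 0 by apply/eqP; rewrite eq_le h norm2_ge0.
by rewrite norm2_rnorm expf_eq0/= => /eqP h2; apply/eqP; rewrite -normr_eq0 norm_real h2.
Qed.

Definition hnorm x := sqrtC (hdot x x).

Lemma hnormD x y : hnorm (x + y) <= hnorm x + hnorm y.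
Proof.
exact: (pd_triangle hdot_linearl hdot_conj hdot_ge0 _ _ hdot_eq0).
Qed.

Lemma hnormZ a x : hnorm (a *: x) = `|a| * hnorm x.
Proof.
rewrite /hnorm (pdZl hdot_linearl) (pdZr hdot_linearl hdot_conj) mulrA -normCK.
by rewrite sqrtCM ?nnegrE ?exprn_ge0 ?hdot_ge0// sqrCK.
Qed.

Lemma hnorm_eq0 x : hnorm x = 0 -> x = 0.
Proof. by move/eqP; rewrite sqrtC_eq0 => /eqP/hdot_eq0. Qed.

HB.instance Definition _ :=
  @Lmodule_isNormed.Build R[i] hsum hnorm hnormD hnormZ hnorm_eq0.

Lemma hdot_normE x : hdot x x = `|x| ^+ 2.
Proof. by rewrite -[LHS]sqrtCK. Qed.

Lemma hsum_norm2E (x : hsum) : norm2 x = fine (\esum_(i in [set: I]) (norm2 (x i))%:E).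
Proof. by apply: complexI; rewrite norm2E -hdot_normE hdotxx. Qed.

End hsum_def.

Section hsum_complete.
Variables (R : realType) (I : choiceType) (E : hilbertType R).

Lemma rnormD (V : normedZmodType R[i]) (x y : V) :
  complex.Re `|x + y| <= complex.Re `|x| + complex.Re `|y|.
Proof. by have := ler_normD x y; rewrite (norm_real (x + y)) (norm_real x) (norm_real y) -rmorphD lecR. Qed.

Lemma rnorm_dist (V : normedZmodType R[i]) (x y : V) :
  `|complex.Re `|x| - complex.Re `|y| | <= complex.Re `|x - y|.
Proof.
rewrite ler_norml lerBlDr -lerBlDl; apply/andP; split; last first.
  by have := rnormD (x - y) y; rewrite subrK addrC; lra.
by have := rnormD (y - x) x; rewrite subrK distrC; lra.
Qed.

Lemma cvg_rnorm (T : Type) (F : set_system T) (V : normedModType R[i]) (f : T -> V) l :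
  Filter F -> f @ F --> l ->
  (fun t => complex.Re `|f t|) @ F --> complex.Re `|l|.
Proof.
move=> FF /cvgrPdist_lt fl; apply/cvgrPdist_lt => e e0.
have /fl : 0 < e%:C%C :> R[i] by rewrite ltcR.
apply: filterS => t; rewrite norm_real ltcR; apply: le_lt_trans.
exact: rnorm_dist.
Qed.

Lemma cvg_norm2 (T : Type) (F : set_system T) (V : normedModType R[i]) (f : T -> V) l :
  Filter F -> f @ F --> l ->
  (fun t => norm2 (f t)) @ F --> norm2 l.
Proof.
move=> FF fl; rewrite norm2_rnorm expr2.
under eq_fun do rewrite norm2_rnorm expr2.
by apply: cvgM; exact: cvg_rnorm.
Qed.

Lemma norm2_coord (x : hsum I E) i : norm2 (x i) <= norm2 x.
Proof.
have := hdot_norm2 x i; congr (_ <= _).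
by apply: complexI; rewrite norm2E -hdot_normE RRe_real// ger0_real// hdot_ge0.
Qed.

Lemma norm2_fsum (x : hsum I E) (A : {fset I}) : \sum_(i <- A) norm2 (x i) <= norm2 x.
Proof.
have := hdot_fsum x A; congr (_ <= _).
by apply: complexI; rewrite norm2E -hdot_normE RRe_real// ger0_real// hdot_ge0.
Qed.

Lemma norm_coord (x : hsum I E) i : `|x i| <= `|x|.
Proof. by rewrite -(@ler_pXn2r _ 2) ?nnegrE// -!norm2E lecR norm2_coord. Qed.

Lemma esum_le_fsets (f : I -> R) (M : R) : (forall A : {fset I}, \sum_(i <- A) f i <= M) ->
  (\esum_(i in [set: I]) (f i)%:E <= M%:E)%E.
Proof.
move=> fM; apply: ge_ereal_sup => _ [A [finA _] <-].
by rewrite fsbig_finite//= sumEFin lee_fin.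
Qed.

Lemma cvg_seqsum (T : Type) (F : set_system T) (r : seq I) (f : I -> T -> R) (l : I -> R) :
  Filter F -> (forall i, f i @ F --> l i) ->
  (fun t => \sum_(i <- r) f i t) @ F --> \sum_(i <- r) l i.
Proof.
move=> FF fl; elim: r => [|i r IH].
  by rewrite big_nil; under eq_fun do rewrite big_nil; exact: cvg_cst.
by rewrite big_cons; under eq_fun do rewrite big_cons; apply: cvgD.
Qed.

Lemma hsum_complete (F : set_system (hsum I E)) :
  ProperFilter F -> cauchy F -> cvg F.
Proof.
move=> FF /cauchyP cF.
have coord i : cvg ((fun x : hsum I E => x i) @ F).
  apply: cauchy_cvg; apply: cauchy_exP => e e0.
  have [x Fx] := cF e e0; exists (x i).
  rewrite /nbhs/=; apply: filterS Fx => y.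
  rewrite -ball_normE /ball_/= -ball_normE /ball_/=.
  exact/le_lt_trans/(norm_coord (x - y)).
pose y i := lim ((fun x : hsum I E => x i) @ F).
have key (e : R) (x0 : hsum I E) : 0 < e -> F (ball x0 e%:C%C) ->
    (\esum_(i in [set: I]) (norm2 (x0 i - y i))%:E <= (e ^+ 2)%:E)%E.
  move=> e0 Fx0; apply: esum_le_fsets => A.
  have cA : (fun x : hsum I E => \sum_(i <- A) norm2 (x0 i - x i)) @ F -->
      \sum_(i <- A) norm2 (x0 i - y i).
    apply: cvg_seqsum => i; apply: cvg_norm2.
    by apply: cvgB; [exact: cvg_cst|exact: coord].
  rewrite -(cvg_lim _ cA)//; apply: limr_le; first by apply/cvg_ex; eexists; exact: cA.
  apply: filterS Fx0 => x; rewrite -ball_normE /ball_/= norm_real ltcR => h.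
  apply: (le_trans (norm2_fsum (x0 - x) A)).
  by rewrite norm2_rnorm ler_pXn2r ?nnegrE ?Re_norm_ge0// ltW.
have ys : sqsummable y.
  have [x0 Fx0] := cF 1%:C%C ltr01.
  have := key _ _ ltr01 Fx0 => h.
  have xy : sqsummable_pred (fun i => x0 i - y i).
    by apply/asboolP; apply: le_lt_trans h _; rewrite ltry.
  have [_ cl] := sqsummable_closed I E.
  have x0s : sqsummable_pred x0 by case: (x0).
  have := cl (-1) _ _ xy x0s => /asboolP; congr sqsummable.
  by apply/funext => i /=; rewrite !fctE scaleN1r opprB subrK.
have ysb : sqsummable_pred y by apply/asboolP.
pose Y : hsum I E := HSum ysb.
apply/cvg_ex; exists Y; apply/cvgrPdist_lt => e e0.
have e_real : e = (complex.Re e)%:C%C by rewrite RRe_real// gtr0_real.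
have e0' : 0 < complex.Re e by rewrite -ltcR -e_real.
have e20 : 0 < complex.Re e / 2 by rewrite divr_gt0.
have [|x0 Fx0] := cF (complex.Re e / 2)%:C%C; first by rewrite ltcR.
have hY : complex.Re `|x0 - Y| <= complex.Re e / 2.
  rewrite -(@ler_pXn2r _ 2) ?nnegrE ?Re_norm_ge0// ?(ltW e20)// -norm2_rnorm.
  rewrite hsum_norm2E -lee_fin fineK ?key//.
  rewrite ge0_fin_numE; last by apply: esum_ge0 => i _; rewrite lee_fin norm2_ge0.
  by apply: le_lt_trans (key _ _ e20 Fx0) _; rewrite ltry.
apply: filterS Fx0 => x; rewrite -ball_normE /ball_/= norm_real ltcR => hx.
rewrite e_real norm_real ltcR.
have := rnormD (Y - x0) (x0 - x); rewrite addrA subrK (distrC Y x0) => h.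
by apply: (le_lt_trans h); rewrite [ltRHS]splitr ler_ltD.
Qed.

HB.instance Definition _ := Uniform_isComplete.Build (hsum I E) hsum_complete.
HB.instance Definition _ := @isHilbert.Build R (hsum I E) (@hdot R I E)
  (@hdot_linearl R I E) (@hdot_conj R I E) (@hdot_normE R I E).

End hsum_complete.

Record closedSubspace (R : realType) (H : hilbertType R) := ClosedSubspace {
  cs_set : set H;
  cs0 : cs_set 0;
  csP : forall (a : R[i]) x y, cs_set x -> cs_set y -> cs_set (a *: x + y);
  cs_closed : closed cs_set
}.

Section closed_subspace.
Variables (R : realType) (H : hilbertType R) (K : closedSubspace H).

Definition cs_pred : {pred H} := fun x => `[< cs_set K x >].

(* K as a Hilbert space, with the structure induced by H. *)
Record cs_type : Type := CsSub { cs_val : H; _ : cs_pred cs_val }.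
HB.instance Definition _ := [isSub for cs_val].
HB.instance Definition _ := [Choice of cs_type by <:].

Lemma cs_submod_closed : submod_closed cs_pred.
Proof.
split=> [|a x y /asboolP xs /asboolP ys]; apply/asboolP; first exact: cs0.
exact: csP.
Qed.

HB.instance Definition _ := GRing.SubChoice_isSubLmodule.Build R[i] H
  cs_pred cs_type (GRing.submod_closed_semi cs_submod_closed).

Let nrm (x : cs_type) : R[i] := `|cs_val x|.
Let nrmD x y : nrm (x + y) <= nrm x + nrm y.
Proof. exact: ler_normD. Qed.
Let nrmZ a x : nrm (a *: x) = `|a| * nrm x.
Proof. by rewrite /nrm -normrZ. Qed.
Let nrm_eq0 x : nrm x = 0 -> x = 0.
Proof. by move/eqP; rewrite normr_eq0 => /eqP x0; apply/val_inj. Qed.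

HB.instance Definition _ :=
  @Lmodule_isNormed.Build R[i] cs_type nrm nrmD nrmZ nrm_eq0.

Lemma cs_normE (x : cs_type) : `|x| = `|cs_val x|. Proof. by []. Qed.

Lemma cs_valP (x : cs_type) : cs_set K (cs_val x).
Proof. by case: x => x xs; exact: (asboolW xs). Qed.

Lemma cs_complete (F : set_system cs_type) : ProperFilter F -> cauchy F -> cvg F.
Proof.
move=> FF /cauchyP cF.
have /cvg_ex[l Fl] : cvg (cs_val @ F).
  apply: cauchy_cvg; apply: cauchy_exP => e e0.
  have [x Fx] := cF e e0; exists (cs_val x).
  rewrite /nbhs/=; apply: filterS Fx => y.
  by rewrite -ball_normE /ball_/= -ball_normE.
have Kl : cs_set K l.
  apply: (closed_cvg (cs_set K) (@cs_closed _ _ K) _ _ Fl).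
  by apply: filterE => x; exact: cs_valP.
have Kl' : cs_pred l by apply/asboolP.
apply/cvg_ex; exists (CsSub Kl'); apply/cvgrPdist_lt => e e0.
by move/cvgrPdist_lt : Fl => /(_ e e0).
Qed.

HB.instance Definition _ := Uniform_isComplete.Build cs_type cs_complete.

Let cdot (x y : cs_type) : R[i] := dot (cs_val x) (cs_val y).
Let cdot_linearl a x y z : cdot (a *: x + y) z = a * cdot x z + cdot y z.
Proof. exact: dot_linearl. Qed.
Let cdot_conj x y : cdot y x = (cdot x y)^*.
Proof. exact: dot_conj. Qed.
Let cdot_normE x : cdot x x = `|x| ^+ 2.
Proof. exact: dot_normE. Qed.
HB.instance Definition _ :=
  @isHilbert.Build R cs_type cdot cdot_linearl cdot_conj cdot_normE.

End closed_subspace.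

Definition orth_compl (R : realType) (H : hilbertType R) (A : set H) : set H :=
  [set x | forall y, A y -> dot x y = 0].

Section projection.
Variables (R : realType) (H : hilbertType R) (K : closedSubspace H).

Definition is_proj (x : H) (p : cs_type K) := orth_compl (cs_set K) (x - cs_val p).

Lemma dotDl (x y z : H) : dot (x + y) z = dot x z + dot y z :> R[i].
Proof. exact: (pdDl (@dot_linearl _ H)). Qed.
Lemma dotDr (x y z : H) : dot z (x + y) = dot z x + dot z y :> R[i].
Proof. exact: (pdDr (@dot_linearl _ H) (@dot_conj _ H)). Qed.
Lemma dotZl a (x z : H) : dot (a *: x) z = a * dot x z :> R[i].
Proof. exact: (pdZl (@dot_linearl _ H)). Qed.
Lemma dotZr a (x z : H) : dot z (a *: x) = a^* * dot z x :> R[i].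
Proof. exact: (pdZr (@dot_linearl _ H) (@dot_conj _ H)). Qed.

Lemma parallelogram (u v : H) :
  norm2 (u + v) + norm2 (u - v) = 2 * norm2 u + 2 * norm2 v.
Proof.
apply: complexI; rewrite !rmorphD !rmorphM /= !norm2E -!dot_normE.
rewrite -[- v]scaleN1r !(dotDl, dotDr, dotZl, dotZr) rmorphN rmorph1 rmorph_nat; ring.
Qed.

Lemma cs_val_cvg (F : set_system (cs_type K)) (p : cs_type K) :
  F --> p -> Filter F -> (@cs_val _ _ K) @ F --> cs_val p.
Proof.
move=> Fp FF; apply/cvgrPdist_lt => e e0.
by move/cvgrPdist_lt : Fp => /(_ e e0).
Qed.

Lemma is_proj_ex x : exists p, is_proj x p.
Proof.
pose D : set R := [set norm2 (x - cs_val k) | k in [set: cs_type K]].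
have D0 : has_inf D.
  split; first by exists (norm2 (x - 0)); exists 0.
  by exists 0 => _ [k _ <-]; exact: norm2_ge0.
pose d := inf D.
have dle (k : cs_type K) : d <= norm2 (x - cs_val k).
  by apply: ge_inf; [exact: D0.2|exists k].
pose A (e : R) := [set k : cs_type K | norm2 (x - cs_val k) < d + e].
pose F : set_system (cs_type K) := filter_from [set e : R | 0 < e] A.
have FF : ProperFilter F.
  apply: filter_from_proper.
    apply: filter_from_filter; first by exists 1 => /=.
    move=> e f /= e0 f0; exists (Num.min e f); first by rewrite /= lt_min e0.
    move=> k; rewrite /A /= => h.
    by split; apply: (lt_le_trans h); rewrite lerD2l ge_min lexx ?orbT.
  move=> e /= e0; have [_ [k _ <-] h] := inf_adherent e0 D0.
  by exists k.
have cF : cauchy F.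
  apply: cauchy_exP => e e0.
  have e_real : e = (complex.Re e)%:C%C by rewrite RRe_real// gtr0_real.
  set r := complex.Re e in e_real.
  have r0 : 0 < r by rewrite -ltcR -e_real.
  have r20 : 0 < r ^+ 2 / 8 by rewrite divr_gt0// exprn_gt0.
  have [_ [k _ <-] hk] := inf_adherent r20 D0.
  exists k, (r ^+ 2 / 8) => //= k' hk'.
  rewrite -ball_normE /ball_/= norm_real e_real ltcR.
  rewrite -(@ltr_pXn2r _ 2) ?nnegrE ?Re_norm_ge0// ?(ltW r0)// -norm2_rnorm.
  have := parallelogram (x - cs_val k) (x - cs_val k').
  pose m : cs_type K := (2^-1 : R[i]) *: (k + k').
  have -> : (x - cs_val k) + (x - cs_val k') = (2 : R[i]) *: (x - cs_val m).
    rewrite /m /= scalerBr scalerA divff ?pnatr_eq0// scale1r scaler_nat mulr2n.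
    by rewrite addrACA -opprD.
  have -> : (x - cs_val k) - (x - cs_val k') = - cs_val (k - k').
    by rewrite /= opprB addrC addrA subrK opprB.
  rewrite norm2Z (_ : norm2 (2 : R[i]) = 4); last first.
    by apply: complexI; rewrite norm2E ger0_norm// -natrX rmorph_nat.
  rewrite [in X in _ + X]norm2_rnorm normrN -norm2_rnorm => h.
  have := dle m; move: hk hk'; rewrite /A /= => hk hk' hm.
  rewrite [ltLHS](_ : _ = norm2 (cs_val (k - k')))//.
  have : 0 <= norm2 (cs_val (k - k')) by exact: norm2_ge0.
  move: h hk; rewrite -/d; lra.
have /cvg_ex[p Fp] : cvg F by exact: cauchy_cvg.
have pd : norm2 (x - cs_val p) <= d.
  apply/ler_addgt0Pr => e e0.
  have cA : (fun k => norm2 (x - cs_val k)) @ F --> norm2 (x - cs_val p).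
    apply: cvg_norm2; apply: cvgB; [exact: cvg_cst|exact: cs_val_cvg].
  rewrite -(cvg_lim _ cA)//; apply: limr_le; first by apply/cvg_ex; eexists; exact: cA.
  by exists e => // k /ltW.
exists p => y Ky; set u := x - cs_val p.
have [y0|yn0] := eqVneq (dot y y) 0.
  by rewrite (dot_eq0 y0) dot_conj (pd0l (@dot_linearl _ H)) rmorph0.
have yp : 0 < dot y y by rewrite lt_def yn0 dot_ge0.
have Ky' : cs_pred K y by apply/asboolP.
pose k : cs_type K := CsSub Ky'.
pose c := dot u y / dot y y.
have := le_trans pd (dle (p + c *: k)).
have -> : x - cs_val (p + c *: k) = u + (- c) *: y.
  by rewrite /= opprD addrA scaleNr.
rewrite -/u -lecR !norm2E -!dot_normE.
clearbody u.
rewrite dotDr !dotDl !dotZr !dotZl (dot_conj u y) rmorphN rmorphM fmorphV /= -(dot_conj y y).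
rewrite (_ : _ + _ = dot u u - dot u y * (dot u y)^* / dot y y); last by rewrite /c; field.
rewrite -normCK lerBrDr gerDl.
rewrite pmulr_lle0 ?invr_gt0// => h; apply/eqP; rewrite -normr_eq0 -sqrf_eq0.
by rewrite eq_le h exprn_ge0.
Qed.

(* The default value 0 of xget is never used, see orth_projP. *)
Definition orth_proj (x : H) : cs_type K := xget 0 [set p | is_proj x p].

Lemma orth_projP x : is_proj x (orth_proj x).
Proof. by have [p xp] := is_proj_ex x; exact: (xgetI 0 xp). Qed.

End projection.

Section hsum_maps.
Variables (R : realType) (E : hilbertType R).

Lemma hsingle_subproof (I : choiceType) (i : I) (v : E) :
  sqsummable_pred (fun k => if k == i then v else 0).
Proof.
apply/asboolP; rewrite /sqsummable (esumID [set i]); last first.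
  by move=> k _; rewrite lee_fin norm2_ge0.
rewrite setTI esum_set1 ?lee_fin ?norm2_ge0// esum1 ?adde0 ?ltry// => k /= [_ ki].
by rewrite ifN ?norm2_0//; apply/eqP.
Qed.

Definition hsingle (I : choiceType) (i : I) (v : E) : hsum I E :=
  HSum (hsingle_subproof i v).

Lemma bshift_subproof (g : hsum int E) : sqsummable_pred (fun n => g (n - 1)).
Proof.
apply/asboolP; case: g => g gs; have := asboolW gs; rewrite /sqsummable /=.
rewrite (@reindex_esum R int int [set: int] [set: int] (fun n => n - 1))//.
split => //; first by move=> x y _ _; exact: addIr.
by move=> y _; exists (y + 1); rewrite ?addrK.
Qed.

(* Multiplication by z: z * \sum_n a_n z^n = \sum_n a_(n-1) z^n. *)
Definition bshift (g : hsum int E) : hsum int E := HSum (bshift_subproof g).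

End hsum_maps.

(* An element a of L2T R J is the sequence of Fourier coefficients of
   g(z) = \sum_n a_n z^n, with a_n in ell2 R J and
   `|g|^2 = \sum_n `|a_n|^2 (hsum_norm2E). *)
Definition ell2 (R : realType) (J : choiceType) : hilbertType R :=
  hsum J (Cplx R).

Definition L2T (R : realType) (J : choiceType) : hilbertType R :=
  hsum int (ell2 R J).

Definition stdbasis (R : realType) (J : choiceType) (j : J) : ell2 R J :=
  hsingle j ((1 : R[i]) : Cplx R).

(* The constant function with value v has v as its only coefficient, at z^0. *)
Definition constant_fun (R : realType) (J : choiceType) (v : ell2 R J) :
  L2T R J := hsingle 0 v.

Definition doubly_invariant (R : realType) (J : choiceType)
    (K : closedSubspace (L2T R J)) : Prop :=
  (forall g, cs_set K g -> cs_set K (bshift g)) /\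
  (forall g, orth_compl (cs_set K) g -> orth_compl (cs_set K) (bshift g)).

Definition bounded_op (R : realType) (E F : hilbertType R) (f : E -> F) : Prop :=
  exists M : R, forall x, `|f x| <= M%:C%C * `|x|.

Record invertible_op (R : realType) (E F : hilbertType R) := InvertibleOp {
  op_fun :> {linear E -> F};
  op_inv : F -> E;
  op_funK : cancel op_fun op_inv;
  op_invK : cancel op_inv op_fun;
  op_fun_bounded : bounded_op op_fun;
  op_inv_bounded : bounded_op op_inv
}.

Definition op_zpow (R : realType) (E : hilbertType R) (T : invertible_op E E)
    (n : int) : E -> E :=
  match n with
  | Posz m => iter m T
  | Negz m => iter m.+1 (op_inv T)
  end.

Definition is_frame (R : realType) (H : hilbertType R) (I : countType)
    (x : I -> H) : Prop :=
  exists A B : R, [/\ 0 < A, 0 < B & forall h : H,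
    ((A * norm2 h)%:E <= \esum_(i in [set: I]) (norm2 (dot h (x i)))%:E /\
     \esum_(i in [set: I]) (norm2 (dot h (x i)))%:E <= (B * norm2 h)%:E)%E].

(* Main.v *)
Require Import Defs.
From HB Require Import structures.
From mathcomp Require Import all_boot all_order all_algebra complex.
From mathcomp Require Import all_classical all_reals all_analysis.
Set Implicit Arguments.
Unset Strict Implicit.
Unset Printing Implicit Defensive.
Import Order.TTheory GRing.Theory Num.Theory.
Import numFieldNormedType.Exports.
Local Open Scope classical_set_scope.
Local Open Scope ring_scope.

(* If the system is a frame, its analysis operator Th : h |-> (<h, T^n f_j>) is
   an isomorphism of H onto a closed subspace K, and Th T^* = U^* Th makes K
   doubly invariant; V is the adjoint of Th : H -> K. Conversely, P_K commutes
   with U, so T^n f_j = V (P_K (z^n e_j)) and the squared coefficients of h sum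
   to `|V^* h|^2, which is comparable to `|h|^2 because V^* is invertible. *)

(** * Inner products, closed sets and Riesz representation *)

Section hilbert.
Variables (R : realType) (E : hilbertType R).
Implicit Types x y z : E.

Lemma dotNl x y : dot (- x) y = - dot x y :> R[i].
Proof. by rewrite -scaleN1r dotZl mulN1r. Qed.

Lemma dotBl x y z : dot (x - y) z = dot x z - dot y z :> R[i].
Proof. by rewrite dotDl dotNl. Qed.

Lemma dot0l x : dot 0 x = 0 :> R[i].
Proof. exact: (pd0l (@dot_linearl _ E)). Qed.

Lemma dot_injl x y : (forall z, dot x z = dot y z) -> x = y.
Proof.
move=> xy; apply/eqP; rewrite -subr_eq0; apply/eqP/dot_eq0.
by rewrite dotBl xy subrr.
Qed.

Lemma dot_injr x y : (forall z, dot z x = dot z y) -> x = y.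
Proof. by move=> xy; apply: dot_injl => z; rewrite dot_conj xy -dot_conj. Qed.

Lemma closed_approx (S : set E) :
  (forall p, (forall e : R, 0 < e -> exists2 x, S x & `|p - x| < e%:C%C) -> S p) ->
  closed S.
Proof.
move=> H p clp; apply: H => e e0.
have [|x [Sx px]] := clp (ball p e%:C%C); first by apply: nbhsx_ballx; rewrite ltcR.
by exists x => //; move: px; rewrite -ball_normE.
Qed.

Lemma norm_small0 (V : normedModType R[i]) (v : V) (M : R) :
  (forall e : R, 0 < e -> `|v| <= (M * e)%:C%C) -> v = 0.
Proof.
move=> vM; apply/eqP; rewrite -normr_eq0 norm_real; apply/eqP; congr (_%:C%C).
apply/eqP; rewrite eq_le Re_norm_ge0 andbT; apply/ler_addgt0Pr => e e0.
(* [M] has no sign, so e is rescaled by the positive number [|M| + 1], which dominates [M]. *)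
rewrite add0r; have M0 : 0 < `|M| + 1 by rewrite ltr_wpDl.
have /vM : 0 < e / (`|M| + 1) by rewrite divr_gt0.
rewrite norm_real lecR => /le_trans; apply.
rewrite mulrCA ler_piMr ?(ltW e0)// ler_pdivrMr// mul1r.
by rewrite (le_trans (ler_norm _))// lerDl.
Qed.

(** The kernel N of [phi] is closed. If [phi] is nonzero, take u orthogonal to N with phi(u)
    nonzero: phi(u) x - phi(x) u lies in N, so its product with u vanishes, which gives phi(x) in
    terms of <x, u>. *)
Lemma riesz (phi : E -> R[i]) (M : R) :
  (forall a x y, phi (a *: x + y) = a * phi x + phi y) ->
  (forall x, `|phi x| <= M%:C%C * `|x|) ->
  exists y, forall x, phi x = dot x y.
Proof.
move=> phil phib.
have phiD x y : phi (x + y) = phi x + phi y.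
  by rewrite -[x]scale1r phil mul1r scale1r.
have phi0 : phi 0 = 0 by apply: (addIr (phi 0)); rewrite -phiD !add0r.
have phiZ a x : phi (a *: x) = a * phi x.
  by rewrite -[a *: x]addr0 phil phi0 addr0.
have phiB x y : phi (x - y) = phi x - phi y.
  by rewrite phiD -scaleN1r phiZ mulN1r.
have clN : closed [set x | phi x = 0].
  apply: closed_approx => p happ /=.
  apply: (@norm_small0 R[i]^o _ `|M|) => e e0.
  have [x /= x0 px] := happ e e0.
  (* For x in the kernel, phi(p) = phi(p - x), which is as small as p - x. *)
  rewrite -[phi p]subr0 -x0 -phiB; apply: (le_trans (phib _)).
  rewrite rmorphM /= (norm_real (p - x)) -!rmorphM lecR.
  move: px; rewrite norm_real ltcR => /ltW px.
  apply: (@le_trans _ _ (`|M| * complex.Re `|p - x|)).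
    by rewrite ler_wpM2r ?Re_norm_ge0// ler_norm.
  by rewrite ler_wpM2l.
pose N := @ClosedSubspace R E _ phi0
  (fun a x y (hx : phi x = 0) (hy : phi y = 0) =>
     etrans (phil a x y) (etrans (congr2 (fun u v => a * u + v) hx hy)
       (etrans (addr0 _) (mulr0 a)))) clN.
have [[x0 px0]|nphi] := pselect (exists x0, phi x0 <> 0); last first.
  exists 0 => x; rewrite dot_conj dot0l conjC0.
  by apply: contrapT => px; apply: nphi; exists x.
(* The component of [x0] orthogonal to the kernel; [phi] takes the same value on both. *)
pose u := x0 - cs_val (orth_proj N x0).
have pu : phi u = phi x0 by rewrite phiB (cs_valP (orth_proj N x0)) subr0.
have uu : dot u u != 0.
  by apply/eqP => /dot_eq0 u0; apply: px0; rewrite -pu u0 phi0.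
(* The conjugate compensates for conjugate linearity of [dot] in its second argument. *)
exists ((phi u / dot u u)^* *: u) => x.
have : dot u (phi u *: x - phi x *: u) = 0.
  by apply: orth_projP => /=; rewrite phiB !phiZ mulrC subrr.
move/(congr1 (@Num.conj _)); rewrite -dot_conj conjC0 dotBl !dotZl => /eqP.
rewrite subr_eq0 => /eqP h.
by rewrite dotZr conjCK mulrAC h mulfK.
Qed.

End hilbert.

(** * Adjoints of bounded and of invertible operators *)

Section adjoint.
Variables (R : realType).
Implicit Types E F : hilbertType R.

Lemma bounded_op_gt0 E F (f : E -> F) : bounded_op f ->
  exists2 M : R, 0 < M & forall x, `|f x| <= M%:C%C * `|x|.
Proof.
move=> [M fM]; exists (`|M| + 1); first by rewrite ltr_wpDl.
move=> x; apply: (le_trans (fM x)); rewrite ler_wpM2r// lecR.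
by rewrite (le_trans (ler_norm M))// lerDl.
Qed.

(** Riesz represents x |-> <f x, y> by a vector g y. Its bound comes from |g y|^2 = <f (g y), y> <=
    M |g y| |y|, divided by |g y| when this is nonzero. *)
Lemma adjoint_ex E F (f : {linear E -> F}) : bounded_op f ->
  exists2 g : {linear F -> E}, bounded_op g &
    forall x y, dot (f x) y = dot x (g y).
Proof.
move=> /bounded_op_gt0[M M0 fM].
have /choice[g gP] : forall y, exists z, forall x, dot (f x) y = dot x z.
  move=> y; apply: (@riesz _ _ _ (M * complex.Re `|y|)) => [a x x'|x].
    by rewrite linearP dot_linearl.
  apply: (le_trans (dot_CS _ _)).
  by rewrite rmorphM /= -norm_real mulrAC ler_wpM2r.
have glin : linear g.
  move=> a y z; apply: dot_injr => x.
  by rewrite -gP !dotDr !dotZr !gP.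
pose lg : {linear F -> E} := HB.pack g (GRing.isLinear.Build R[i] F E _ g glin).
exists lg => //; exists M => y /=.
have [->|gy0] := eqVneq (g y) 0; first by rewrite normr0 mulr_ge0// ler0c ltW.
rewrite -(@ler_pM2l _ `|g y|) ?normr_gt0// -expr2 -dot_normE -gP.
(* The product <f (g y), y> equals <g y, g y>, hence its own modulus, and Cauchy-Schwarz applies. *)
have := dot_ge0 (g y); rewrite -gP => /ger0_norm <-.
apply: (le_trans (dot_CS _ _)); rewrite mulrA ler_wpM2r// mulrC.
by rewrite mulrC (le_trans (fM _))// mulrC.
Qed.

Lemma op_inv_linear E F (f : invertible_op E F) : linear (op_inv f).
Proof.
move=> a x y; apply: (can_inj (op_funK f)).
by rewrite linearP !op_invK.
Qed.

(** The adjoint of the inverse inverts the adjoint. *)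
Lemma adjoint_op E F (f : invertible_op E F) :
  exists g : invertible_op F E, forall x y, dot (f x) y = dot x (g y).
Proof.
pose fi : {linear F -> E} := HB.pack (op_inv f)
  (GRing.isLinear.Build R[i] F E _ (op_inv f) (op_inv_linear f)).
have [g gb gP] := adjoint_ex (op_fun_bounded f).
have [k kb kP] := @adjoint_ex _ _ fi (op_inv_bounded f).
have gK : cancel g k.
  by move=> y; apply: dot_injr => x; rewrite -kP -gP op_invK.
have kK : cancel k g.
  by move=> y; apply: dot_injr => x; rewrite -gP -kP /= op_funK.
by exists (InvertibleOp gK kK gb kb).
Qed.

Lemma norm2_bounded_op E F (f : E -> F) : bounded_op f ->
  exists2 M : R, 0 < M & forall x, norm2 (f x) <= M * norm2 x.
Proof.
move=> /bounded_op_gt0[M M0 fM]; exists (M ^+ 2); first exact: exprn_gt0.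
move=> x; rewrite !norm2_rnorm -exprMn ler_pXn2r ?nnegrE ?Re_norm_ge0//.
  by rewrite -lecR rmorphM /= -!norm_real.
by rewrite mulr_ge0 ?Re_norm_ge0// ltW.
Qed.

Lemma bounded_op_norm2 E F (f : E -> F) (M : R) : 0 <= M ->
  (forall x, norm2 (f x) <= M * norm2 x) -> bounded_op f.
Proof.
move=> M0 fM; exists (Num.sqrt M) => x.
rewrite (norm_real (f x)) (norm_real x) -rmorphM lecR.
rewrite -(@ler_pXn2r _ 2) ?nnegrE ?Re_norm_ge0//; last first.
  by rewrite mulr_ge0 ?Re_norm_ge0// sqrtr_ge0.
by rewrite exprMn sqr_sqrtr// -!norm2_rnorm.
Qed.

End adjoint.

(** * Sums, coefficients and the shift on L^2 *)

Section series.
Variables (R : realType).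

Lemma reindex_rsum (I J : choiceType) (e : I -> J) (f : J -> R) :
  bijective e -> rsum (f \o e) = rsum f.
Proof.
rewrite -setTT_bijective => eb; rewrite /rsum.
rewrite !(reindex_esum _ _ _ _ eb); congr (fine (_ - _)%E); apply: eq_esum => i _;
  by rewrite ?funeposE ?funenegE.
Qed.

Lemma esum_single (I : choiceType) (i : I) (f : I -> \bar R) :
  (forall k, 0 <= f k)%E -> (forall k, k != i -> f k = 0%E) ->
  esum [set: I] f = f i.
Proof.
move=> f0 fi; rewrite (esumID [set i]); last by move=> k _; exact: f0.
rewrite setTI esum_set1// esum1 ?adde0// => k /= [_ ki].
by apply: fi; apply/eqP.
Qed.

Lemma rsum_single (I : choiceType) (i : I) (f : I -> R) :
  (forall k, k != i -> f k = 0) -> rsum f = f i.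
Proof.
move=> fi; rewrite /rsum !(@esum_single _ i).
(* The remaining term is the positive part minus the negative part of [f i]. *)
- by have /(congr1 (fun h => h i)) /= <- := funeposneg (EFin \o f).
- by move=> k; exact: funeneg_ge0.
- by move=> k ki; rewrite funenegE/= fi// oppr0 maxxx.
- by move=> k; exact: funepos_ge0.
- by move=> k ki; rewrite funeposE/= fi// maxxx.
Qed.

Lemma csum_single (I : choiceType) (i : I) (F : I -> R[i]) :
  (forall k, k != i -> F k = 0) -> csum F = F i.
Proof.
move=> Fi; rewrite /csum !(@rsum_single _ i); first by case: (F i).
  by move=> k /Fi ->.
by move=> k /Fi ->.
Qed.

Lemma dot_hsingle (I : choiceType) (E : hilbertType R) (g : hsum I E) i (v : E) :
  dot g (hsingle i v) = dot (g i) v :> R[i].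
Proof.
transitivity (csum (fun k => dot (g k) (hsingle i v k))) => //.
rewrite (@csum_single _ i) /= ?eqxx// => k /negPf ->.
by rewrite dot_conj dot0l conjC0.
Qed.

Lemma hsum_norm2EFin (I : choiceType) (E : hilbertType R) (g : hsum I E) :
  (norm2 g)%:E = (\esum_(i in [set: I]) (norm2 (g i))%:E)%E.
Proof.
rewrite hsum_norm2E fineK// ge0_fin_numE; last first.
  by apply: esum_ge0 => i _; rewrite lee_fin norm2_ge0.
exact/sqsummableP/hsum_summable.
Qed.

(** The shift is isometric because n |-> n - 1 permutes the coefficients. *)
Lemma dot_bshift (E : hilbertType R) (g h : hsum int E) :
  dot (bshift g) (bshift h) = dot g h :> R[i].
Proof.
have bij : bijective (fun n : int => n - 1).
  by exists (fun n => n + 1) => n; rewrite ?addrK ?subrK.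
rewrite -[LHS]/(hdot _ _) -[RHS]/(hdot _ _) /hdot /csum.
congr Complex.
  exact: (reindex_rsum (fun n => complex.Re (dot (g n) (h n))) bij).
exact: (reindex_rsum (fun n => complex.Im (dot (g n) (h n))) bij).
Qed.

Lemma bshiftB (E : hilbertType R) (g h : hsum int E) :
  bshift (g - h) = bshift g - bshift h.
Proof. exact/val_inj. Qed.

Lemma bshift_hsingle (E : hilbertType R) n (v : E) :
  bshift (hsingle n v) = hsingle (n + 1) v :> hsum int E.
Proof. by apply/val_inj/funext => k /=; rewrite subr_eq. Qed.

Lemma dot_Cplx1 (a : Cplx R) : dot a ((1 : R[i]) : Cplx R) = a :> R[i].
Proof. by rewrite -[LHS]/((a : R[i]) * (1 : R[i])^*) conjC1 mulr1. Qed.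

(** The second factor is z^n e_j, so products with these functions read off coordinates. *)
Lemma dot_monomial (J : choiceType) (g : L2T R J) n j :
  dot g (hsingle n (stdbasis R j)) = (g n : ell2 R J) j :> R[i].
Proof. by rewrite dot_hsingle dot_hsingle dot_Cplx1. Qed.

(** Parseval for the functions z^n e_j: terms are nonnegative, so the iterated sum regroups over
    pairs. *)
Lemma L2T_norm2 (J : choiceType) (g : L2T R J) :
  (norm2 g)%:E =
    (\esum_(p in [set: int * J]) (norm2 ((g p.1 : ell2 R J) p.2))%:E)%E.
Proof.
rewrite hsum_norm2EFin.
under eq_esum do rewrite hsum_norm2EFin.
rewrite esum_esum; last by move=> *; rewrite lee_fin norm2_ge0.
by congr esum; apply/seteqP; split.
Qed.

End series.

(** * Uniqueness and adjointness of the projection *)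

Section projection.
Variables (R : realType) (E : hilbertType R) (K : closedSubspace E).

(** The difference of two candidates lies in K and is also orthogonal to K. *)
Lemma is_proj_uniq x (p : cs_type K) : is_proj x p -> orth_proj K x = p.
Proof.
move=> xp; have xq := orth_projP (K := K) x.
apply/eqP; rewrite -subr_eq0; apply/eqP/dot_eq0.
set d := _ - p; transitivity (dot (cs_val d) (cs_val d)) => //.
have dE : cs_val d = (x - cs_val p) - (x - cs_val (orth_proj K x)).
  by rewrite opprB addrC addrA subrK.
by rewrite {1}dE dotBl (xp _ (cs_valP d)) (xq _ (cs_valP d)) subrr.
Qed.

(** The projection is the adjoint of the inclusion of K, since x - P_K x is orthogonal to K. *)
Lemma dot_orth_proj (g : cs_type K) x : dot (cs_val g) x = dot g (orth_proj K x).
Proof.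
rewrite -[RHS]/(dot (cs_val g) (cs_val (orth_proj K x))).
apply: (inv_inj (@conjCK R[i])); rewrite -!dot_conj.
by apply/eqP; rewrite -subr_eq0 -dotBl (orth_projP x (cs_valP g)).
Qed.

End projection.

(** * Integer powers of an invertible operator *)

Section zpow.
Variables (R : realType) (E : hilbertType R) (T : invertible_op E E).

Lemma op_zpowD1 (n : int) x : op_zpow T (n + 1) x = T (op_zpow T n x).
Proof.
case: n => [m|[|m]].
- by rewrite -PoszD addn1.
(* The case n = -1, where n + 1 changes constructor of [int]. *)
- by rewrite /= op_invK.
- have -> : Negz m.+1 + 1 = Negz m by rewrite !NegzE -[in LHS]addn1 PoszD opprD subrK.
  by rewrite /= op_invK.
Qed.

(** The recursion determines positive indices directly, and negative ones because T is injective. *)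
Lemma op_zpow_uniq (a : int -> E) : (forall n, a (n + 1) = T (a n)) ->
  forall n, a n = op_zpow T n (a 0).
Proof.
move=> aT; elim/int_rec => // n IH; first by rewrite -addn1 PoszD aT IH -op_zpowD1.
apply: (can_inj (op_funK T)); rewrite -aT -op_zpowD1.
by rewrite -addn1 PoszD opprD subrK.
Qed.

End zpow.

(** * Closed range of an operator bounded below *)

Lemma closed_range (R : realType) (E F : hilbertType R) (f : {linear E -> F}) :
  bounded_op f -> (exists2 c : R, 0 < c & forall x, c * norm2 x <= norm2 (f x)) ->
  closed (range f).
Proof.
move=> [M fM] [c c0 fc]; apply: closed_approx => p happ.
pose A (e : R) := [set x : E | `|p - f x| < e%:C%C].
(* The approximate preimages of p generate a filter; the lower bound on f makes it Cauchy, and its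
   limit is a preimage of p. *)
pose G : set_system E := filter_from [set e : R | 0 < e] A.
have GG : ProperFilter G.
  apply: filter_from_proper.
    apply: filter_from_filter; first by exists 1 => /=.
    move=> e d /= e0 d0; exists (Num.min e d); first by rewrite /= lt_min e0.
    by move=> x; rewrite /A /= norm_real !ltcR lt_min => /andP[].
  by move=> e /= /happ[_ [x _ <-] px]; exists x.
have cG : cauchy G.
  apply: cauchy_exP => e e0.
  have e_real : e = (complex.Re e)%:C%C by rewrite RRe_real// gtr0_real.
  set r := complex.Re e in e_real.
  have r0 : 0 < r by rewrite -ltcR -e_real.
  (* Chosen so that (2 d)^2 = c r^2: two points of [A d] have images less than 2 d apart, hence lie
     less than r apart. *)
  pose d := Num.sqrt c * r / 2.
  have d0 : 0 < d by rewrite divr_gt0// mulr_gt0// sqrtr_gt0.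
  have [_ [x _ <-] px] := happ d d0.
  exists x, d => // y; rewrite /A /= => py.
  rewrite -ball_normE /ball_/= e_real norm_real ltcR.
  rewrite -(@ltr_pXn2r _ 2) ?nnegrE ?Re_norm_ge0// ?(ltW r0)// -norm2_rnorm.
  rewrite -(ltr_pM2l c0); apply: (le_lt_trans (fc _)).
  have -> : c * r ^+ 2 = (d + d) ^+ 2.
    by rewrite /d -splitr exprMn sqr_sqrtr// ltW.
  rewrite norm2_rnorm ltr_pXn2r ?nnegrE ?Re_norm_ge0 ?addr_ge0 ?(ltW d0)//.
  rewrite linearB (_ : f x - f y = (f x - p) + (p - f y)); last by rewrite addrA subrK.
  apply: (le_lt_trans (rnormD _ _)); rewrite ltrD// -ltcR -norm_real//.
  by rewrite distrC.
have /cvg_ex[x Gx] : cvg G by exact: cauchy_cvg.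
exists x => //; apply/esym/eqP; rewrite -subr_eq0; apply/eqP.
(* For y close to x and in [A e], p - f y contributes e and f (x - y) contributes [|M|] e. *)
apply: (@norm_small0 _ _ _ (1 + `|M|)) => e e0.
have /cvgrPdist_lt/(_ e%:C%C) : id @ G --> x by [].
rewrite ltcR => /(_ e0)/= {}Gx.
have Ge : G (A e) by exists e.
have [y [/= xy py]] := @filter_ex _ G _ _ (@filterI _ G _ _ _ Gx Ge).
rewrite (_ : p - f x = (p - f y) - f (x - y)); last first.
  by rewrite linearB opprB addrA subrK.
apply: (le_trans (ler_normB _ _)); rewrite mulrDl mul1r rmorphD lerD//; first exact: ltW py.
apply: (le_trans (fM _)).
move: xy; rewrite norm_real ltcR -rmorphM lecR => /ltW xy.
apply: (@le_trans _ _ (`|M| * complex.Re `|x - y|)).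
  by rewrite ler_wpM2r ?Re_norm_ge0// ler_norm.
by rewrite ler_wpM2l.
Qed.

(** * Frames of orbits and the shift model *)

Section unitary_model.
Variables (R : realType) (H : hilbertType R) (T : invertible_op H H).
Variables (J : countType) (f : J -> H).

Lemma unitary_model_frame (K : closedSubspace (L2T R J))
    (V : invertible_op (cs_type K) H) : doubly_invariant K ->
  (forall g : cs_type K, cs_val (op_inv V (T (V g))) = bshift (cs_val g)) ->
  (forall j : J, V (orth_proj K (constant_fun (stdbasis R j))) = f j) ->
  is_frame (fun p : int * J => op_zpow T p.1 (f p.2)).
Proof.
move=> [KU KoU] VT Vf.
(* Invariance of the complement puts U (x - P_K x) in it, so U P_K x is the projection of U x. *)
have TVP x : T (V (orth_proj K x)) = V (orth_proj K (bshift x)).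
  apply: (can_inj (op_invK V)); rewrite op_funK; apply/esym/is_proj_uniq.
  by rewrite /is_proj VT -bshiftB; apply/KoU/orth_projP.
pose e n j : L2T R J := hsingle n (stdbasis R j).
have VPe j n : V (orth_proj K (e n j)) = op_zpow T n (f j).
  rewrite -Vf; apply: (@op_zpow_uniq _ _ T (fun n => V (orth_proj K (e n j)))) => k.
  by rewrite TVP bshift_hsingle.
have [W VW] := adjoint_op V.
(* With W = V^*, <h, V P_K e> = <W h, P_K e> = <W h, e> for e = z^n e_j, a coordinate of W h. *)
have dotW h n j : norm2 (dot h (op_zpow T n (f j))) =
    norm2 ((cs_val (W h) n : ell2 R J) j).
  by rewrite -VPe dot_conj VW -dot_conj -dot_orth_proj dot_monomial.
have sumW h : (\esum_(p in [set: int * J])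
    (norm2 (dot h (op_zpow T p.1 (f p.2))))%:E = (norm2 (W h))%:E)%E.
  rewrite -[RHS]/((norm2 (cs_val (W h)))%:E) L2T_norm2.
  by apply: eq_esum => -[n j] _; rewrite dotW.
have [B B0 WB] := norm2_bounded_op (op_fun_bounded W).
have [A A0 WA] := norm2_bounded_op (op_inv_bounded W).
(* [A] bounds the inverse of W, so its reciprocal bounds W from below. *)
exists A^-1, B; split; rewrite ?invr_gt0// => h.
rewrite sumW !lee_fin WB; split => //.
by rewrite -[in leLHS](op_funK W h) mulrC ler_pdivrMr// mulrC.
Qed.

Lemma frame_unitary_model : is_frame (fun p : int * J => op_zpow T p.1 (f p.2)) ->
  exists (K : closedSubspace (L2T R J)) (V : invertible_op (cs_type K) H),
    [/\ doubly_invariant K,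
        forall g : cs_type K, cs_val (op_inv V (T (V g))) = bshift (cs_val g) &
        forall j : J, V (orth_proj K (constant_fun (stdbasis R j))) = f j].
Proof.
move=> [A [B [A0 B0 fAB]]].
pose c h n j : Cplx R := dot h (op_zpow T n (f j)).
have csum_pair h : (\esum_(n in [set: int]) \esum_(j in [set: J]) (norm2 (c h n j))%:E =
    \esum_(p in [set: int * J]) (norm2 (dot h (op_zpow T p.1 (f p.2))))%:E)%E.
  rewrite esum_esum; last by move=> *; rewrite lee_fin norm2_ge0.
  by congr esum; apply/seteqP; split.
have fin2 h : (\esum_(n in [set: int]) \esum_(j in [set: J])
    (norm2 (c h n j))%:E < +oo)%E.
  by rewrite csum_pair (le_lt_trans (fAB h).2)// ltry.
have c1 h n : sqsummable_pred (c h n).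
  apply/asboolP; apply: le_lt_trans (fin2 h).
  (* The inner sum at n is a single term of the finite outer sum. *)
  apply: esum_ge; exists [set n]; last by rewrite fsbig_set1.
  by split=> //; exact: finite_set1.
have c2 h : sqsummable_pred (fun n => HSum (c1 h n) : ell2 R J).
  apply/asboolP; apply: le_lt_trans (fin2 h).
  by apply: le_esum => n _; rewrite hsum_norm2EFin.
pose Th h : L2T R J := HSum (c2 h).
have Thlin : linear Th.
  by move=> a x y; apply/val_inj/funext => n; apply/val_inj/funext => j;
    exact: dot_linearl.
have ThN h : (norm2 (Th h))%:E =
    (\esum_(p in [set: int * J]) (norm2 (dot h (op_zpow T p.1 (f p.2))))%:E)%E.
  by rewrite L2T_norm2.
have ThA h : A * norm2 h <= norm2 (Th h) by rewrite -lee_fin ThN; exact: (fAB h).1.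
have ThB h : norm2 (Th h) <= B * norm2 h by rewrite -lee_fin ThN; exact: (fAB h).2.
pose lTh : {linear H -> L2T R J} :=
  HB.pack Th (GRing.isLinear.Build R[i] H (L2T R J) _ Th Thlin).
have Thb : bounded_op lTh by exact: (bounded_op_norm2 (ltW B0) ThB).
have clK : closed (range lTh) by apply: closed_range => //; exists A.
have K0 : range lTh 0 by exists 0; rewrite ?linear0.
have KP (a : R[i]) x y : range lTh x -> range lTh y -> range lTh (a *: x + y).
  by move=> [u _ <-] [v _ <-]; exists (a *: u + v); rewrite ?linearP.
pose K := ClosedSubspace K0 KP clK.
have KTh h : cs_pred K (lTh h) by apply/asboolP; exists h.
pose S h : cs_type K := CsSub (KTh h).
have Slin : linear S by move=> a x y; apply/val_inj; exact: Thlin.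
pose lS : {linear H -> cs_type K} :=
  HB.pack S (GRing.isLinear.Build R[i] H (cs_type K) _ S Slin).
have /choice[Si SiK] : forall g : cs_type K, exists h, S h = g.
  move=> g; have [h _ hg] := cs_valP g.
  by exists h; apply/val_inj.
have Sinj h : Si (S h) = h.
  apply/eqP; rewrite -subr_eq0; apply/eqP.
  (* The lower frame bound forces two vectors with the same image to coincide. *)
  have := ThA (Si (S h) - h).
  rewrite -[norm2 (Th _)]/(norm2 (lS _)) linearB /= SiK subrr norm2_0.
  rewrite pmulr_rle0// => n0.
  have /eqP : norm2 (Si (S h) - h) = 0 by apply/eqP; rewrite eq_le n0 norm2_ge0.
  rewrite norm2_rnorm sqrf_eq0 => /eqP z; apply/eqP.
  by rewrite -normr_eq0 norm_real z.
have lSb : bounded_op lS by exact: Thb.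
have Sib : bounded_op Si.
  apply: (@bounded_op_norm2 _ _ _ _ A^-1) => [|g]; first by rewrite invr_ge0 ltW.
  by rewrite mulrC ler_pdivlMr// mulrC -{2}(SiK g); exact: ThA.
pose Sop : invertible_op H (cs_type K) := @InvertibleOp _ _ _ lS Si Sinj SiK lSb Sib.
have [V SV] := adjoint_op Sop.
have dotV g h : dot (V g) h = dot (cs_val g) (Th h).
  by rewrite dot_conj -SV -dot_conj.
have [Ta TaP] := adjoint_op T.
(* The intertwining relation Th T^* = U^* Th, stated without inverting U. *)
have UTh h : bshift (Th (Ta h)) = Th h.
  apply/val_inj/funext => n; apply/val_inj/funext => j /=; rewrite /c.
  rewrite dot_conj -TaP -dot_conj; congr dot.
  by rewrite -op_zpowD1 subrK.
have KU g : cs_set K g -> cs_set K (bshift g).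
  (* Surjectivity of T^* writes h as T^* k, and then U Th h = Th k. *)
  move=> [h _ <-]; exists (op_inv Ta h) => //=.
  by rewrite -[in RHS](op_invK Ta h) UTh.
exists K, V; split.
- split=> [|g gK _ [h _ <-]]; first exact: KU.
  (* For g orthogonal to K, <U g, Th h> = <U g, U Th T^* h> = <g, Th T^* h> = 0. *)
  by rewrite -[lTh h]/(Th h) -UTh dot_bshift; apply: gK; exists (Ta h).
- move=> g; have KUg : cs_pred K (bshift (cs_val g)) by apply/asboolP/KU/cs_valP.
  suff -> : T (V g) = V (CsSub KUg) by rewrite op_funK.
  (* <T V g, h> = <g, Th T^* h> = <U g, U Th T^* h> = <U g, Th h> = <V U g, h>. *)
  by apply: dot_injl => h; rewrite TaP !dotV /= -[in RHS]UTh dot_bshift.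
(* <P_K e_j, Th h> = <e_j, Th h> is the conjugate of the entry (0, j) of Th h, that is <f_j, h>, as
   T^0 is the identity. *)
- move=> j; apply: dot_injl => h; rewrite dotV.
  rewrite -[LHS]/(dot (orth_proj K (constant_fun (stdbasis R j))) (S h)).
  by rewrite dot_conj -dot_orth_proj dot_monomial [RHS]dot_conj.
Qed.

End unitary_model.

Theorem theorem3p1 (R : realType) (H : hilbertType R) (T : invertible_op H H)
    (J : countType) (f : J -> H) :
  is_frame (fun p : int * J => op_zpow T p.1 (f p.2)) <->
  exists (K : closedSubspace (L2T R J)) (V : invertible_op (cs_type K) H),
    [/\ doubly_invariant K,
        forall g : cs_type K, cs_val (op_inv V (T (V g))) = bshift (cs_val g) &
        forall j : J, V (orth_proj K (constant_fun (stdbasis R j))) = f j].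
Proof.
split; first exact: frame_unitary_model.
by move=> [K [V [KU VT Vf]]]; exact: (unitary_model_frame KU VT Vf).
Qed.
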